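(* Fix $k\in\mathbb{N}$. Let $G=(V,E)$ be a mixed $k$-multigraph. Let $N\in\mathbb{N}$ and for every $u\in V$ let $x_u\in\mathbb{R}^N$ with $\|x_u\|\in[1,2]$. Then $G$ has a $2$-cut of surplus at least $$-\sum_{e\in E} C_{|e|}\sum_{u\ne v\in e}\langle x_u,x_v\rangle-O_k\Big(\sum_{e\in E}\sum_{u\ne v\in e}\langle x_u,x_v\rangle^2\Big),$$ where $C_{|e|}$ are positive constants depending only on the size $|e|$.
   Context: A mixed $k$-multigraph is a multihypergraph all of whose edges have size at most $k$. A $2$-cut is a partition of the vertex set into two parts; its size is the number of edges (counted with multiplicity) having a vertex in each part. The surplus of a $2$-cut is its size minus the expected size of a uniformly random $2$-cut (each vertex independently in either part with probability $1/2$). $O_k(\cdot)$ hides a constant depending only on $k$. *)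

(* Defs.v *)
From HB Require Import structures.
From mathcomp Require Import all_boot all_order all_algebra.
From mathcomp Require Import finmap multiset.
From mathcomp Require Import reals.
Set Implicit Arguments.
Unset Strict Implicit.
Unset Printing Implicit Defensive.
Import Order.TTheory GRing.Theory Num.Theory.

Local Open Scope mset_scope.
Local Open Scope ring_scope.

(* Edges are sets of vertices, occurring with multiplicity: a sum
   \sum_(e <- G) ranges over the edges of G counted with multiplicity. *)
Definition multihypergraph (V : finType) := {mset {set V}}.
Identity Coercion mset_of_multihypergraph : multihypergraph >-> multiset_of.

Definition mixed_multigraph (k : nat) (V : finType) (G : multihypergraph V) :=
  forall e : {set V}, e \in G -> (#|e| <= k)%N.

(* A 2-cut of V is represented by one of its parts, A; the other part is ~: A.
   A part may be empty, as it may be in the random 2-cut. *)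
Definition is_cut (V : finType) (A e : {set V}) : bool :=
  (e :&: A != set0) && (e :&: ~: A != set0).

Definition cut_size (V : finType) (G : multihypergraph V) (A : {set V}) : nat :=
  (\sum_(e <- G) is_cut A e)%N.

(* When each vertex is put in A independently with probability 1/2, A is
   uniformly distributed among the 2 ^ #|V| subsets of V. *)
Definition expected_cut_size (R : realType) (V : finType)
    (G : multihypergraph V) : R :=
  (\sum_(A : {set V}) (cut_size G A)%:R) / 2 ^+ #|V|.

Definition surplus (R : realType) (V : finType) (G : multihypergraph V)
    (A : {set V}) : R :=
  (cut_size G A)%:R - expected_cut_size R G.

(* The norm `|x| of the library is the sup norm on row vectors, hence the
   explicit Euclidean structure. *)
Definition dotv (R : realType) (N : nat) (x y : 'rV[R]_N) : R :=
  \sum_(i < N) x 0 i * y 0 i.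

Definition norm2 (R : realType) (N : nat) (x : 'rV[R]_N) : R :=
  Num.sqrt (dotv x x).

(* Main.v *)
(* Round a Gaussian vector g: conditionally on g, put u in A independently with
   probability (1 - c_u sin <g, x_u>) / 2, where c_u = exp(|x_u|^2 / 2 - 2) <= 1.
   The sine makes every moment explicit: with eta uniform in {-1, 1}^V,
     E prod_(u in S) c_u sin <g, x_u>
       = Re((-i)^|S|) e^(-2|S|) E_eta [prod_(u in S) eta_u e^(-Q(eta))],
     Q(eta) = sum_(u < v in S) eta_u eta_v <x_u, x_v>.
   The weights c_u cancel the norms of the x_u. Expanding e^(-Q) to first order,
   orthogonality of the Walsh functions leaves e^(-4) <x_u, x_v> for S = {u, v}
   and nothing for larger S, with an error O(E Q^2). The indicator that a
   nonempty edge e is uncut is 2^-|e| times the sum over subsets S of e of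
   (1 + (-1)^|S|) prod_(u in S) eta_u, so only these moments matter.
   The Gaussian enters only through the nonnegativity of the cut distribution
   with these moments; for this, g is approximated by normalised sums of m
   random signs, as prod_i cos(w_i / sqrt m)^m -> e^(-|w|^2 / 2). *)
From mathcomp Require Import classical_sets topology normedtype derive.
From mathcomp Require Import sequences exp trigo complex ring lra.
Require Import Defs.
From HB Require Import structures.
From mathcomp Require Import all_boot all_order all_algebra.
From mathcomp Require Import finmap multiset.
From mathcomp Require Import reals.
Set Implicit Arguments.
Unset Strict Implicit.
Unset Printing Implicit Defensive.
Import Order.TTheory GRing.Theory Num.Theory.
Import numFieldNormedType.Exports.
Local Open Scope ring_scope.

(** * Elementary estimates for exp, cos and products *)

Section RealAnalysis.
Variable R : realType.
Implicit Types x y z : R.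

(** Applying 1 + t <= e^t at t = z and t = -z gives 0 <= e^z - 1 - z <= z (e^z - 1). The bound [B]
    is one-sided because it serves for z = -Q(eta), which is estimated from above only. *)
Lemma expR_taylor1 z B : z <= B -> 0 <= B ->
  `|expR z - 1 - z| <= z ^+ 2 * expR B.
Proof.
move=> zB B0; have e1 := expR_ge1Dx z.
rewrite ger0_norm; last by lra.
have e2 : expR z - 1 <= z * expR z.
  have := expR_ge1Dx (- z); rewrite expRN => h.
  have ez := expR_gt0 z.
  by move: h; rewrite -(ler_pM2r ez) mulVf ?gt_eqF //; lra.
have [z0|z0] := leP 0 z.
  have h : expR z - 1 <= z * expR B.
    by apply: le_trans e2 _; rewrite ler_wpM2l // ler_expR.
  apply: (@le_trans _ _ (z * (expR z - 1))); first by lra.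
  by rewrite expr2 -mulrA ler_wpM2l.
have hB : 1 <= expR B by rewrite -expR0 ler_expR.
apply: (@le_trans _ _ (z ^+ 2)); first by nra.
by rewrite ler_peMr // sqr_ge0.
Qed.

Lemma sin_mean y : 0 < y -> exists2 c, 0 < c < y & sin y = cos c * y.
Proof.
move=> y0; have ds x : x \in `]0, y[ -> is_derive x 1 (@sin R) (cos x).
  by move=> _; exact: is_derive_sin.
have cs : {within `[0, y], continuous (@sin R)}%classic.
  by apply: continuous_subspaceT => x; exact: continuous_sin.
have [c] := MVT y0 ds cs.
by rewrite in_itv /= sin0 !subr0; exists c.
Qed.

(** Both terms are within y^4 / 4 of 1 - y^2 / 2. For the cosine, write cos y = 1 - 2 sin(y/2)^2 and
    apply the mean value theorem twice to bound sin(y/2)^2 on both sides. *)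
Lemma cos_expR_bound y : `|cos y - expR (- (y ^+ 2 / 2))| <= y ^+ 4.
Proof.
wlog y0 : y / 0 < y.
  move=> H; have [y0|y0|<-] := ltgtP 0 y; first exact: H.
    have := H (- y); rewrite oppr_gt0 => /(_ y0).
    by rewrite cosN sqrrN exprNn -signr_odd expr0 mul1r.
  by rewrite cos0 !expr0n /= mul0r oppr0 expR0 subrr normr0.
have [c /andP[c0 cy] sy] := sin_mean (divr_gt0 y0 (ltr0Sn R 1)).
have [d _ sc] := sin_mean c0.
have Ey : cos y = 1 - 2 * sin (y / 2) ^+ 2.
  have {1}-> : y = (y / 2) *+ 2 by rewrite mulr2n; lra.
  by rewrite cos_mulr2n cos2sin2 mulr2n; lra.
have := @expR_taylor1 (- (y ^+ 2 / 2)) 0.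
rewrite expR0 mulr1 => /(_ _ (lexx _)) h.
have {}h : `|expR (- (y ^+ 2 / 2)) - 1 - - (y ^+ 2 / 2)| <= (- (y ^+ 2 / 2)) ^+ 2.
  by apply: h; have := sqr_ge0 y; lra.
have hc2 : (y / 2) ^+ 2 * (1 - c ^+ 2) <= sin (y / 2) ^+ 2 <= (y / 2) ^+ 2.
  rewrite sy [(cos c * _) ^+ 2]exprMn [_ * (y / 2) ^+ 2]mulrC; apply/andP; split.
    rewrite ler_wpM2l ?sqr_ge0 // cos2sin2 lerD2l lerN2 sc exprMn.
    by rewrite ler_piMl ?sqr_ge0 // cos2sin2; have := sqr_ge0 (sin d); lra.
  by rewrite ler_piMr ?sqr_ge0 // cos2sin2; have := sqr_ge0 (sin c); lra.
have c2 : c ^+ 2 <= (y / 2) ^+ 2.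
  by rewrite ler_sqr ?nnegrE; lra.
have hc3 : (y / 2) ^+ 2 * (1 - (y / 2) ^+ 2) <= sin (y / 2) ^+ 2.
  case/andP: hc2 => h1 _; apply: le_trans h1.
  by rewrite ler_wpM2l ?sqr_ge0 // lerD2l lerN2.
case/andP: hc2 => _ hc2.
have y4 : y ^+ 4 = y ^+ 2 * y ^+ 2 by rewrite -exprD.
move: h hc2 hc3; rewrite Ey y4 sqrrN !expr_div_n.
have := sqr_ge0 y; set s := sin _ ^+ 2; set Y := y ^+ 2; set E := expR _ => Y0.
rewrite !ler_norml => /andP[h1 h2] h3 h4.
by apply/andP; split; nra.
Qed.

Lemma prod_dist (I : finType) (a b : I -> R) :
  (forall i, `|a i| <= 1) -> (forall i, `|b i| <= 1) ->
  `|\prod_i a i - \prod_i b i| <= \sum_i `|a i - b i|.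
Proof.
move=> ha hb.
(* Factors are exchanged one at a time; the induction also needs the partial products of [a] to stay
   in [-1, 1]. *)
suff [] : `|\prod_i a i - \prod_i b i| <= \sum_i `|a i - b i| /\ `|\prod_i a i| <= 1.
  by [].
elim/big_rec3 : _ => [|i s q p _ [pq p1]]; first by rewrite subrr normr0 normr1.
split; last by rewrite normrM mulr_ile1.
have -> : a i * p - b i * q = (a i - b i) * p + b i * (p - q) by ring.
apply: le_trans (ler_normD _ _) _; rewrite !normrM lerD //.
  by rewrite ler_piMr.
by apply: le_trans pq; rewrite ler_piMl.
Qed.

End RealAnalysis.

(** * Sign vectors and orthogonality of Walsh functions *)

Section SignSums.
Variables (F : comNzRingType) (T : finType).
Implicit Types (B S : {set T}) (u : T).

(** A set [B] encodes the sign vector that is -1 exactly on [B]. This serves for eta, for the cut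
    [A] and for the signs approximating the Gaussian. *)
Definition sgn_at B u : F := (-1) ^+ (u \in B).
Definition walsh B S : F := \prod_(u in S) sgn_at B u.

Lemma sum_prod_if (f g : T -> F) :
  \sum_(B : {set T}) \prod_u (if u \in B then f u else g u)
  = \prod_u (f u + g u).
Proof. by rewrite bigA_distr. Qed.

Lemma prod_sgn (h : T -> F -> F) :
  \sum_(B : {set T}) \prod_u h u (sgn_at B u) = \prod_u (h u (-1) + h u 1).
Proof.
rewrite -sum_prod_if; apply: eq_bigr => B _; apply: eq_bigr => u _.
by rewrite /sgn_at; case: ifP.
Qed.

Lemma walshE B S : walsh B S = \prod_u (if u \in S then sgn_at B u else 1).
Proof. by rewrite /walsh big_mkcond. Qed.

Lemma sum_walsh2 S S' :
  \sum_B walsh B S * walsh B S' = (S == S')%:R * 2 ^+ #|T|.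
Proof.
under eq_bigr => B _ do rewrite !walshE -big_split /=.
rewrite (prod_sgn (fun u s => (if u \in S then s else 1) * (if u \in S' then s else 1))).
case: eqVneq => [->|/eqP neq].
  rewrite mul1r -[#|T|]/#|predT| -prodr_const; apply: eq_bigr => u _.
  by case: ifP; rewrite ?mulrNN !mulr1.
(* An element of exactly one of the two sets contributes the factor -1 + 1 = 0. *)
rewrite mul0r; have [u hu] : exists u, (u \in S) != (u \in S').
  apply/existsP; apply: contra_notT neq => /existsPn h.
  by apply/setP => u; apply/eqP; rewrite -[_ == _]negbK h.
rewrite (bigD1 u) //=; move: hu; case: (u \in S); case: (u \in S') => //= _;
by rewrite ?mulr1 ?mul1r addNr mul0r.
Qed.

End SignSums.

(** * Trigonometric moments of random sign sums *)

Section TrigSums.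
Variable R : realType.
Definition cis (t : R) : R[i] := Complex (cos t) (sin t).

Lemma cis_sum (I : finType) (P : pred I) (t : I -> R) :
  cis (\sum_(i | P i) t i) = \prod_(i | P i) cis (t i).
Proof.
apply: (big_morph cis) => [x y|]; last by rewrite /cis cos0 sin0.
by rewrite /cis cosD sinD; congr Complex; rewrite addrC [sin x * _]mulrC.
Qed.

Lemma cis_sgn (T : finType) (B : {set T}) u (t : R) :
  cis (sgn_at R B u * t) = if u \in B then cis (- t) else cis t.
Proof. by rewrite /sgn_at; case: ifP => _; rewrite ?mulN1r ?mul1r. Qed.

Lemma sum_cis (T : finType) (t : T -> R) :
  \sum_(B : {set T}) cis (\sum_u sgn_at R B u * t u)
  = (2 ^+ #|T| * \prod_u cos (t u))%:C%C.
Proof.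
transitivity (\sum_(B : {set T}) \prod_u (if u \in B then cis (- t u) else cis (t u))).
  by apply: eq_bigr => B _; rewrite cis_sum; apply: eq_bigr => u _; rewrite cis_sgn.
rewrite sum_prod_if -[#|T|]/#|predT| -prodr_const -big_split rmorph_prod /=.
apply: eq_bigr => u _.
by rewrite /cis cosN sinN /real_complex_def; congr Complex; rewrite ?addNr //; ring.
Qed.

(** Indices in [S] contribute e^(it) - e^(-it) = 2i sin t, the others 1 + 1. *)
Lemma sum_walsh_cis (T : finType) (S : {set T}) (t : T -> R) :
  \sum_(B : {set T}) (walsh R B S)%:C%C * cis (\sum_(u in S) sgn_at R B u * t u)
  = 2 ^+ #|T| * ('i%C ^+ #|S| * (\prod_(u in S) sin (t u))%:C%C).
Proof.
transitivity (\sum_(B : {set T}) \prod_u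
    (if u \in B then if u \in S then - cis (- t u) else 1
     else if u \in S then cis (t u) else 1)).
  apply: eq_bigr => B _; rewrite cis_sum rmorph_prod -big_split big_mkcond /=.
  apply: eq_bigr => u _; rewrite cis_sgn /sgn_at.
  by case: (u \in B); case: (u \in S); rewrite // ?rmorphN ?rmorph1 ?mulN1r ?mul1r.
rewrite sum_prod_if -[#|T|]/#|predT| -!prodr_const rmorph_prod -big_split /=.
rewrite [X in _ = _ * X]big_mkcond -big_split /=.
apply: eq_bigr => u _; case: ifP => _; last by rewrite mulr1.
rewrite /cis cosN sinN; apply/eqP; rewrite eq_complex; apply/andP; split; apply/eqP.
  by rewrite /=; ring.
by rewrite /=; ring.
Qed.

(** The values are 1, 0, -1, 0, repeating, so moments of odd order vanish. *)
Definition kappa s : R := complex.Re ((- 'i%C : R[i]) ^+ s).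

Lemma kappa0 : kappa 0 = 1. Proof. by []. Qed.
Lemma kappa2 : kappa 2 = -1. Proof. by rewrite /kappa sqrrN sqr_i. Qed.

Lemma kappa_le1 s : `|kappa s| <= 1.
Proof.
have := normc_ge_Re ((- 'i%C : R[i]) ^+ s).
by rewrite normrX normrN normc_def /= expr0n expr1n add0r sqrtr1 expr1n lecR.
Qed.

(** Sum [walsh R B S] times e^(i theta), where theta is the sum of eta_u g_j t_uj, over both [B] and
    [g]. Summing over [B] first yields sines, over [g] first cosines. *)
Lemma sum_prod_sin (V T : finType) (S : {set V}) (t : V -> T -> R) :
  (\sum_(g : {set T}) \prod_(u in S) sin (\sum_j sgn_at R g j * t u j)) / 2 ^+ #|T|
  = kappa #|S| * (\sum_(B : {set V}) walsh R B S *
      \prod_j cos (\sum_(u in S) sgn_at R B u * t u j)) / 2 ^+ #|V|.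
Proof.
set X := \sum_(g : _) _; set Y := \sum_(B : {set V}) _.
have two0 n : (2 : R) ^+ n != 0 by rewrite expf_neq0 // pnatr_eq0.
have key : 2 ^+ #|V| * ('i%C ^+ #|S| * X%:C%C) = (2 ^+ #|T| * Y)%:C%C.
  rewrite /X rmorph_sum /= !mulr_sumr.
  under eq_bigr do rewrite -sum_walsh_cis.
  rewrite exchange_big rmorph_sum /=; apply: eq_bigr => B _.
  rewrite -mulr_sumr mulrCA rmorphM; congr (_ * _).
  rewrite /= -sum_cis; apply: eq_bigr => g _; congr (cis _).
  under eq_bigr do rewrite mulr_sumr.
  rewrite exchange_big /=; apply: eq_bigr => j _.
  by rewrite mulr_sumr; apply: eq_bigr => u _; rewrite mulrCA.
(* Multiplying by (-i)^|S| cancels i^|S|; then real parts are taken. *)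
have : 2 ^+ #|V| * X = kappa #|S| * (2 ^+ #|T| * Y).
  have {key} := congr1 (fun z => complex.Re ((- 'i%C) ^+ #|S| * z)) key.
  rewrite mulrCA [_ * ('i%C ^+ _ * _)]mulrA -exprMn mulNr -expr2 sqr_i opprK expr1n mul1r.
  have -> : (2 : R[i]) ^+ #|V| = (2 ^+ #|V|)%:C%C by rewrite rmorphXn rmorph_nat.
  rewrite -rmorphM /= /kappa => ->; case: (_ ^+ #|S|) => a b /=.
  by rewrite mulr0 subr0.
move=> E; apply: (mulfI (two0 #|V|)); rewrite mulrA E.
by field; rewrite !two0.
Qed.

End TrigSums.

(** * Expansion of a product over the subsets of an edge *)

Section Subsets.
Variables (R : comNzRingType) (V : finType).

Lemma prod_addr1 (e : {set V}) (f : V -> R) :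
  \prod_(u in e) (f u + 1) = \sum_(S : {set V} | S \subset e) \prod_(u in S) f u.
Proof.
rewrite big_mkcond /=.
transitivity (\prod_u ((if u \in e then f u else 0) + 1)).
  by apply: eq_bigr => u _; case: ifP; rewrite ?add0r.
rewrite -sum_prod_if [RHS]big_mkcond; apply: eq_bigr => S _ /=.
case: ifPn => [Se|/subsetPn[u uS /negbTE ue]].
  rewrite [RHS]big_mkcond; apply: eq_bigr => u _.
  by case: ifPn => // /(subsetP Se) ->.
by rewrite (bigD1 u) //= uS ue mul0r.
Qed.

End Subsets.

(** * Passage from random signs to the Gaussian *)

Section GaussianLimit.
Variable R : realType.

(** Replaces a limit in m: it suffices to control an error of order 1/m. *)
Lemma ge0_of_archimedean (X D : R) :
  (forall m : nat, 0 <= X + D / m.+1%:R) -> 0 <= X.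
Proof.
move=> h; rewrite leNgt; apply/negP => X0.
have D0 : 0 <= D / - X.
  by have := h 0%N; rewrite divr1 => hD; rewrite divr_ge0 //; lra.
have := archi_boundP D0; set n := Num.bound _; rewrite ltr_pdivrMr ?oppr_gt0 // => hn.
have n1 : (0 : R) < n.+1%:R by rewrite ltr0Sn.
have := h n; rewrite -(pmulr_lge0 _ n1) mulrDl divfK ?gt_eqF //.
by rewrite -natr1 mulrDr; lra.
Qed.

(** Each Gaussian coordinate becomes [m.+1] signs scaled by 1 / sqrt(m+1). A factor errs by at most
    w_i^4 / (m+1)^2, and there are m+1 factors for each i. *)
Lemma prod_cos_approx (N m : nat) (w : 'I_N -> R) :
  `|\prod_(p : 'I_N * 'I_m.+1) cos (w p.1 / Num.sqrt m.+1%:R)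
    - expR (- ((\sum_i w i ^+ 2) / 2))| <= (\sum_i w i ^+ 4) / m.+1%:R.
Proof.
set s := Num.sqrt _.
have s2 : s ^+ 2 = m.+1%:R by rewrite sqr_sqrtr ?ler0n.
have m0 : m.+1%:R != 0 :> R by rewrite pnatr_eq0.
have sum_fst (f : 'I_N -> R) :
    \sum_(p : 'I_N * 'I_m.+1) f p.1 = m.+1%:R * \sum_i f i.
  rewrite -(pair_bigA _ (fun i j => f i)) mulr_sumr; apply: eq_bigr => i _.
  by rewrite /= sumr_const card_ord mulr_natl.
have -> : expR (- ((\sum_i w i ^+ 2) / 2))
    = \prod_(p : 'I_N * 'I_m.+1) expR (- ((w p.1 / s) ^+ 2 / 2)).
  rewrite -expR_sum; congr expR.
  rewrite (sum_fst (fun i => - ((w i / s) ^+ 2 / 2))) mulr_sumr mulr_suml -sumrN.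
  by apply: eq_bigr => i _; rewrite expr_div_n s2; field; rewrite nat1r.
apply: le_trans (prod_dist _ _) _ => [p|p|].
- exact: cos_max.
- by rewrite ger0_norm ?expR_ge0 // expR_le1 oppr_le0 divr_ge0 ?sqr_ge0.
apply: le_trans (ler_sum _ (fun p _ => cos_expR_bound (w p.1 / s))) _.
rewrite (sum_fst (fun i => (w i / s) ^+ 4)) mulr_sumr mulr_suml ler_sum // => i _.
by rewrite expr_div_n -[4%N]/(2 * 2)%N [s ^+ _]exprM s2 le_eqVlt; apply/orP; left;
  apply/eqP; field; rewrite nat1r.
Qed.

End GaussianLimit.

(** * Moments of the rounded Gaussian and their positivity *)

Section Moments.
Variables (R : realType) (V : finType) (N : nat) (x : V -> 'rV[R]_N).
Hypothesis hx : forall u, dotv (x u) (x u) <= 4.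
Implicit Types S B A e : {set V}.

Definition weight u : R := expR (dotv (x u) (x u) / 2 - 2).

Definition signed_sum B S (i : 'I_N) : R := \sum_(u in S) sgn_at R B u * x u 0 i.

(* The Gaussian expectation of the product over S of weight u * sin <g, x u>,
   obtained from [sum_prod_sin] with the products of cosines replaced by their
   limits. *)
Definition moment S : R :=
  (\prod_(u in S) weight u) * kappa R #|S| *
  (\sum_(B : {set V}) walsh R B S *
     expR (- ((\sum_i signed_sum B S i ^+ 2) / 2))) / 2 ^+ #|V|.

Lemma moment0 : moment set0 = 1.
Proof.
rewrite /moment big_set0 cards0 kappa0 !mul1r.
rewrite (eq_bigr (fun B => walsh R B set0 * walsh R B set0)) => [|B _].
  by rewrite sum_walsh2 eqxx mul1r divff // expf_neq0 // pnatr_eq0.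
rewrite /walsh big_set0 !mul1r big1 ?mul0r ?oppr0 ?expR0 // => i _.
by rewrite /signed_sum big_set0 expr0n.
Qed.

(** The sum is 2^|V| times the probability of the cut [A]. With finitely many signs it becomes an
    average of products of factors 1 + [sgn_at R A u * f u g], nonnegative since |f| <= 1, and the
    change is at most D / (m+1). *)
Lemma moment_ge0 A : 0 <= \sum_S walsh R A S * moment S.
Proof.
pose a S := walsh R A S * ((\prod_(u in S) weight u) * kappa R #|S| / 2 ^+ #|V|).
pose D := \sum_S `|a S| * \sum_B `|walsh R B S| * \sum_i signed_sum B S i ^+ 4.
apply: (@ge0_of_archimedean _ _ D) => m.
pose T : finType := ('I_N * 'I_m.+1)%type.
pose s : R := Num.sqrt m.+1%:R.
pose t u (p : T) := x u 0 p.1 / s.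
pose f u (g : {set T}) := weight u * sin (\sum_p sgn_at R g p * t u p).
pose Phi B S := \prod_(p : T) cos (signed_sum B S p.1 / s).
have f1 u g : `|f u g| <= 1.
  rewrite /f normrM mulr_ile1 // ?sin_max // ger0_norm ?expR_ge0 // expR_le1.
  by have := hx u; lra.
(* Expand the product over subsets [S] and apply [sum_prod_sin] to each term. *)
have E : (\sum_(g : {set T}) \prod_u (sgn_at R A u * f u g + 1)) / 2 ^+ #|T|
    = \sum_S a S * \sum_B walsh R B S * Phi B S.
  under eq_bigr => g _.
    rewrite (eq_bigl (fun u => u \in [set: V])) => [|u]; last by rewrite inE.
    rewrite prod_addr1.
    over.
  rewrite exchange_big mulr_suml /= (eq_bigl xpredT) => [|S]; last by rewrite subsetT.
  apply: eq_bigr => S _.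
  under eq_bigr do rewrite big_split big_split /= mulrA.
  rewrite -mulr_sumr -mulrA sum_prod_sin /a -!mulrA; do 3 congr (_ * _).
  rewrite [RHS]mulrC; congr (_ / _); apply: eq_bigr => B _; congr (_ * _).
  apply: eq_bigr => p _; congr cos; rewrite /signed_sum mulr_suml.
  by apply: eq_bigr => u _; rewrite mulrA.
have E0 : 0 <= \sum_S a S * \sum_B walsh R B S * Phi B S.
  rewrite -E divr_ge0 ?exprn_ge0 // sumr_ge0 // => g _; apply: prodr_ge0 => u _.
  have := f1 u g; rewrite ler_norml => /andP[h1 h2].
  by rewrite /sgn_at; case: (_ \in _); rewrite ?mulN1r ?mul1r; lra.
apply: le_trans E0 _; rewrite addrC -lerBlDr -sumrB /D mulr_suml ler_sum // => S _.
have -> : walsh R A S * moment S = a S * \sum_B walsh R B S *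
     expR (- ((\sum_i signed_sum B S i ^+ 2) / 2)).
  by rewrite /moment /a; ring.
rewrite -mulrBr -sumrB; apply: le_trans (ler_norm _) _.
rewrite normrM -mulrA ler_wpM2l // mulr_suml.
apply: le_trans (ler_norm_sum _ _ _) _; apply: ler_sum => B _.
by rewrite -mulrBr normrM -mulrA ler_wpM2l // prod_cos_approx.
Qed.

End Moments.

(** * Sums over pairs of vertices *)

Section PairSums.
Variables (R : realType) (V : finType).
Implicit Types (S : {set V}) (F : V -> V -> R).

(** Pairs are ordered, as in the theorem, so each unordered pair counts twice; hence the halving in
    [quad]. *)
Definition pair_sum S F : R := \sum_(u in S) \sum_(v in S | v != u) F u v.

(** Cauchy-Schwarz against the constant 1, by 2 t_i t_j <= t_i^2 + t_j^2. *)
Lemma sqr_sum_le (I : finType) (P : pred I) (t : I -> R) :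
  (\sum_(i | P i) t i) ^+ 2 <= #|P|%:R * \sum_(i | P i) t i ^+ 2.
Proof.
have amgm : \sum_(i | P i) \sum_(j | P j) t i * t j
    <= \sum_(i | P i) \sum_(j | P j) (t i ^+ 2 / 2 + t j ^+ 2 / 2).
  apply: ler_sum => i _; apply: ler_sum => j _.
  by have := sqr_ge0 (t i - t j); lra.
rewrite expr2 big_distrlr /=; apply: le_trans amgm _.
rewrite (eq_bigr (fun i => t i ^+ 2 / 2 *+ #|P| + \sum_(j | P j) t j ^+ 2 / 2)) => [|i _].
  by rewrite big_split sumr_const /= sumrMnl -mulr_suml -mulrnDl -splitr mulr_natl.
by rewrite big_split sumr_const.
Qed.

Lemma sqr_pair_sum_le S F :
  pair_sum S F ^+ 2 <= #|S|%:R ^+ 2 * pair_sum S (fun u v => F u v ^+ 2).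
Proof.
apply: le_trans (sqr_sum_le _ _) _.
rewrite expr2 -mulrA ler_wpM2l ?ler0n //.
rewrite /pair_sum mulr_sumr; apply: ler_sum => u _.
apply: le_trans (sqr_sum_le _ _) _; rewrite ler_wpM2r //.
  by apply: sumr_ge0 => v _; exact: sqr_ge0.
by rewrite ler_nat subset_leq_card //; apply/subsetP => v /andP[].
Qed.

Lemma pair_sum_ge0 S F : (forall u v, 0 <= F u v) -> 0 <= pair_sum S F.
Proof. by move=> F0; do 2 (apply: sumr_ge0 => ? _). Qed.

Lemma pair_sum_subset S S' F : (forall u v, 0 <= F u v) -> S \subset S' ->
  pair_sum S F <= pair_sum S' F.
Proof.
move=> F0 SS'; rewrite /pair_sum big_mkcond [leRHS]big_mkcond ler_sum // => u _.
case: ifPn => uS; last by case: ifP => // _; apply: sumr_ge0.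
rewrite (subsetP SS' _ uS) big_mkcond [leRHS]big_mkcond ler_sum // => v _.
have [vS|_] := boolP (v \in S); first by rewrite (subsetP SS' _ vS).
by case: ifP.
Qed.

(** Moves the dependence on [S] into an indicator, so that sums over [S] can be exchanged with sums
    over pairs. *)
Lemma pair_sumE S F :
  pair_sum S F = \sum_u \sum_(v | v != u) (([set u; v] \subset S)%:R * F u v).
Proof.
rewrite /pair_sum big_mkcond; apply: eq_bigr => u _.
rewrite big_mkcondl; case: ifPn => uS.
  apply: eq_bigr => v _; rewrite subUset !sub1set uS.
  by case: ifP; rewrite ?mul1r ?mul0r.
rewrite big1 // => v _.
by rewrite subUset !sub1set (negbTE uS) mul0r.
Qed.

End PairSums.

(** * First-order expansion of the moments *)

Section MomentExpansion.
Variables (R : realType) (V : finType) (N : nat) (x : V -> 'rV[R]_N).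
Hypothesis hx : forall u, dotv (x u) (x u) <= 4.
Implicit Types S B A e : {set V}.

Let a u v := dotv (x u) (x v).

Definition quad B S : R :=
  pair_sum S (fun u v => sgn_at R B u * sgn_at R B v * a u v) / 2.

Lemma sgn_at_sqr B u : sgn_at R B u * sgn_at R B u = 1.
Proof. by rewrite /sgn_at -expr2 sqrr_sign. Qed.

Lemma norm_sgn_at B u : `|sgn_at R B u| = 1.
Proof. by rewrite /sgn_at normr_sign. Qed.

Lemma sqr_signed_sum B S :
  \sum_i signed_sum x B S i ^+ 2 = \sum_(u in S) a u u + 2 * quad B S.
Proof.
under eq_bigr do rewrite /signed_sum expr2 big_distrlr /=.
rewrite exchange_big /quad mulrC divfK ?pnatr_eq0 // -big_split /=.
apply: eq_bigr => u uS; rewrite exchange_big (bigD1 u) //=; congr (_ + _).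
  by apply: eq_bigr => i _; rewrite mulrACA sgn_at_sqr mul1r.
apply: eq_bigr => v _; rewrite /a /dotv mulr_sumr.
by apply: eq_bigr => i _; rewrite mulrACA.
Qed.

(** The diagonal terms |x_u|^2 / 2 of the exponent carry no sign and cancel against the weights,
    leaving e^(-2) per vertex. *)
Lemma momentE S :
  moment x S = kappa R #|S| * expR (- 2 * #|S|%:R)
    * (\sum_(B : {set V}) walsh R B S * expR (- quad B S)) / 2 ^+ #|V|.
Proof.
rewrite /moment [_ * kappa _ _]mulrC -!mulrA; congr (_ * _).
rewrite !mulrA; congr (_ / _); rewrite !mulr_sumr; apply: eq_bigr => B _.
rewrite ![_ * (walsh _ _ _ * _)]mulrCA; congr (_ * _).
rewrite sqr_signed_sum /weight -expR_sum -!expRD; congr expR.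
by rewrite big_split /= -mulr_suml sumr_const -mulr_natr; field.
Qed.

(** The squared length of the signed sum of the x_u is nonnegative, and its diagonal part is at most
    4|S|. *)
Lemma quad_ge B S : - quad B S <= 2 * #|S|%:R.
Proof.
have h1 : 0 <= \sum_i signed_sum x B S i ^+ 2.
  by apply: sumr_ge0 => i _; exact: sqr_ge0.
have h2 : \sum_(u in S) a u u <= \sum_(u in S) 4.
  by apply: ler_sum => u _; exact: hx.
move: h1 h2; rewrite sqr_signed_sum sumr_const -mulr_natr; lra.
Qed.

Lemma sqr_quad_le B S :
  quad B S ^+ 2 <= #|S|%:R ^+ 2 / 4 * pair_sum S (fun u v => a u v ^+ 2).
Proof.
have -> : quad B S ^+ 2 = (quad B S * 2) ^+ 2 / 4 by field.
rewrite [leRHS]mulrAC ler_wpM2r ?invr_ge0 ?ler0n // divfK ?pnatr_eq0 //.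
apply: le_trans (sqr_pair_sum_le _ _) _.
rewrite le_eqVlt; apply/orP; left; apply/eqP; congr (_ * _).
apply: eq_bigr => u _; apply: eq_bigr => v _.
by rewrite !exprMn /sgn_at !sqrr_sign !mul1r.
Qed.

Lemma walsh_pair B u v : v != u -> walsh R B [set u; v] = sgn_at R B u * sgn_at R B v.
Proof. by move=> vu; rewrite /walsh big_setU1 ?big_set1 // inE eq_sym. Qed.

Lemma sum_walsh B0 : \sum_(B : {set V}) walsh R B B0 = (B0 == set0)%:R * 2 ^+ #|V|.
Proof.
rewrite -sum_walsh2; apply: eq_bigr => B _.
by rewrite [walsh R B set0]/walsh big_set0 mulr1.
Qed.

(** Each term of [quad] is a multiple of the Walsh function of a pair, so orthogonality keeps only S
    = {u, v}. *)
Lemma sum_walsh_quad S : \sum_(B : {set V}) walsh R B S * quad B S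
  = (\sum_u \sum_(v | v != u) (S == [set u; v])%:R * a u v) / 2 * 2 ^+ #|V|.
Proof.
rewrite /quad; under eq_bigr do rewrite mulrA pair_sumE.
rewrite -mulr_suml mulrAC; congr (_ / 2); rewrite mulr_suml.
under eq_bigr do rewrite mulr_sumr.
rewrite exchange_big; apply: eq_bigr => u _ /=.
under eq_bigr do rewrite mulr_sumr.
rewrite exchange_big mulr_suml; apply: eq_bigr => v vu /=.
have -> : (S == [set u; v])%:R * a u v * 2 ^+ #|V| = 
  ([set u; v] \subset S)%:R * a u v * ((S == [set u; v])%:R * 2 ^+ #|V|).
  by case: eqVneq => [->|_]; rewrite ?subxx ?mul1r // !(mul0r, mulr0).
rewrite -sum_walsh2 mulr_sumr; apply: eq_bigr => B _.
by rewrite walsh_pair //; ring.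
Qed.

(** In e^(-Q) = 1 - Q + remainder, the constant averages to 0 as [S] is nonempty and Q gives the
    pair term. The remainder is at most Q^2 e^(2|S|), whose exponential is cancelled by
    e^(-2|S|). *)
Lemma moment_expansion S : S != set0 ->
  `|moment x S + kappa R #|S| * expR (- 2 * #|S|%:R)
      * (\sum_u \sum_(v | v != u) (S == [set u; v])%:R * a u v) / 2|
  <= #|S|%:R ^+ 2 / 4 * pair_sum S (fun u v => a u v ^+ 2).
Proof.
move=> S0; set q := leRHS.
have n0 : 0 < (2 : R) ^+ #|V| by rewrite exprn_gt0.
have -> : moment x S + kappa R #|S| * expR (- 2 * #|S|%:R)
      * (\sum_u \sum_(v | v != u) (S == [set u; v])%:R * a u v) / 2
  = kappa R #|S| * (\sum_(B : {set V}) walsh R B S *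
      (expR (- 2 * #|S|%:R) * (expR (- quad B S) - 1 - - quad B S))) / 2 ^+ #|V|.
  have -> : \sum_(B : {set V}) walsh R B S *
      (expR (- 2 * #|S|%:R) * (expR (- quad B S) - 1 - - quad B S))
    = expR (- 2 * #|S|%:R) * (\sum_B walsh R B S * expR (- quad B S)
       - \sum_B walsh R B S + \sum_B walsh R B S * quad B S).
    rewrite -sumrB -big_split mulr_sumr; apply: eq_bigr => B _ /=; ring.
  rewrite sum_walsh (negbTE S0) mul0r subr0 sum_walsh_quad momentE.
  by field; rewrite gt_eqF.
rewrite normf_div (gtr0_norm n0) ler_pdivrMr //.
have -> : q * 2 ^+ #|V| = \sum_(B : {set V}) q.
  have := sum_walsh set0; rewrite eqxx mul1r => <-.
  by rewrite mulr_sumr; apply: eq_bigr => B _; rewrite /walsh big_set0 mulr1.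
rewrite normrM; apply: le_trans (ler_piMl _ (kappa_le1 _ _)) _ => //.
apply: le_trans (ler_norm_sum _ _ _) _; apply: ler_sum => B _.
rewrite normrM [X in X * _](_ : _ = 1) ?mul1r; last first.
  by rewrite /walsh normr_prod big1 // => u _; exact: norm_sgn_at.
rewrite normrM ger0_norm ?expR_ge0 //.
apply: le_trans (sqr_quad_le B S).
have := expR_taylor1 (quad_ge B S) (mulr_ge0 (ler0n R 2) (ler0n R _)).
rewrite -(ler_pM2l (expR_gt0 (- 2 * #|S|%:R))) => h; apply: le_trans h _.
by rewrite mulrCA -expRD mulNr addNr expR0 mulr1 sqrrN.
Qed.

End MomentExpansion.

(** * Walsh expansion of the surplus *)

Section Cuts.
Variables (R : realType) (V : finType).
Implicit Types S A e : {set V}.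

(** An edge is uncut if it lies in [~: A] (the term 1) or in [A] (the term (-1)^|S|). *)
Definition even_factor S : R := 1 + (-1) ^+ #|S|.

Lemma even_factor_bounds S : 0 <= even_factor S <= 2.
Proof. by rewrite /even_factor -signr_odd; case: odd; rewrite ?expr0 ?expr1; lra. Qed.

Lemma prod_indicator (P : pred V) e :
  \prod_(u in e) (P u)%:R = [forall (u | u \in e), P u]%:R :> R.
Proof.
case: forallP => [h|/forallP].
  by rewrite big1 // => u ue; have /implyP -> := h u.
rewrite negb_forall => /existsP[u]; rewrite negb_imply => /andP[ue /negbTE Pu].
by rewrite (bigD1 u) //= Pu mul0r.
Qed.

(** The indicator of u outside [A] is (1 + [sgn_at R A u]) / 2; expand the product over [e]. *)
Lemma subset_setC_walsh A e : (e \subset ~: A)%:R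
  = (2 ^- #|e|) * \sum_(S : {set V} | S \subset e) walsh R A S.
Proof.
rewrite /walsh -prod_addr1 -exprVn -prodr_const -big_split /=.
rewrite (eq_bigr (fun u => (u \notin A)%:R)) => [|u _].
  by rewrite prod_indicator; congr (nat_of_bool _)%:R;
    apply/subsetP/forall_inP => h u /h; rewrite inE.
by rewrite /sgn_at; case: (u \in A) => /=; lra.
Qed.

Lemma subset_walsh A e : (e \subset A)%:R
  = (2 ^- #|e|) * \sum_(S : {set V} | S \subset e) (-1) ^+ #|S| * walsh R A S.
Proof.
rewrite -[A in LHS]setCK subset_setC_walsh; congr (_ * _); apply: eq_bigr => S _.
rewrite /walsh -prodr_const -big_split; apply: eq_bigr => u _.
by rewrite /sgn_at inE; case: (u \in A) => /=; rewrite ?mulrNN ?mulr1 ?mul1r.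
Qed.

(** The probability that [e] is cut. The empty edge is treated apart: it is never cut, while the
    formula would give -1. *)
Definition cut_mean e : R := (e != set0)%:R * (1 - 2 ^- #|e| * 2).

Lemma is_cut_walsh A e : (is_cut A e)%:R = cut_mean e
  - 2 ^- #|e| * \sum_(S : {set V} | (S \subset e) && (S != set0))
      even_factor S * walsh R A S.
Proof.
rewrite /cut_mean /is_cut; have [->|e0] := eqVneq e set0.
  rewrite set0I eqxx mul0r big1 ?mulr0 ?subr0 // => S /andP[].
  by rewrite subset0 => ->.
have -> : ((e :&: A != set0) && (e :&: ~: A != set0))%:R
    = 1 - (e \subset A)%:R - (e \subset ~: A)%:R :> R.
  rewrite !setI_eq0 !disjoints_subset finset.setCK.
  have [eA|_] /= := boolP (e \subset A).
    have [eC|_] := boolP (e \subset ~: A); last by rewrite /=; lra.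
    by case/negP: e0; rewrite -subset0 -(setICr A) subsetI eA.
  by case: (_ \subset _) => /=; lra.
rewrite subset_setC_walsh subset_walsh mul1r -addrA -opprD -mulrDr -big_split /=.
rewrite (bigD1 set0) ?sub0set //= /walsh big_set0 cards0 expr0 mulr1 mulrDr opprD addrA.
congr (1 - _ - _ * _); apply: eq_bigr => S _.
by rewrite /even_factor mulrDl mul1r addrC.
Qed.

Lemma sum_is_cut e : \sum_(A : {set V}) (is_cut A e)%:R = cut_mean e * 2 ^+ #|V|.
Proof.
under eq_bigr do rewrite is_cut_walsh.
rewrite sumrB -[RHS]subr0; congr (_ - _).
  have := sum_walsh R (set0 : {set V}); rewrite eqxx mul1r => <-; rewrite mulr_sumr.
  by apply: eq_bigr => A _; rewrite /walsh big_set0 mulr1.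
rewrite -mulr_sumr exchange_big big1 ?mulr0 //= => S /andP[_ /negbTE S0].
by rewrite -mulr_sumr sum_walsh S0 mul0r mulr0.
Qed.

Lemma surplus_walsh (G : multihypergraph V) A : surplus R G A
  = - \sum_(e <- G) 2 ^- #|e| *
      \sum_(S : {set V} | (S \subset e) && (S != set0)) even_factor S * walsh R A S.
Proof.
have n0 : (2 : R) ^+ #|V| != 0 by rewrite expf_neq0 // pnatr_eq0.
rewrite /surplus /expected_cut_size.
under eq_bigr do rewrite /cut_size natr_sum.
rewrite exchange_big mulr_suml /cut_size natr_sum -sumrB -sumrN.
apply: eq_bigr => e _ /=.
by rewrite sum_is_cut mulfK // is_cut_walsh addrC addKr.
Qed.

Lemma exists_ge_mean (I : finType) (P f : I -> R) :
  (forall i, 0 <= P i) -> \sum_i P i = 1 -> exists i, \sum_j P j * f j <= f i.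
Proof.
move=> P0 P1; have [i0|I0] := pickP (@predT I); last first.
  by move: P1; rewrite big_pred0 // => /eqP; rewrite eq_sym oner_eq0.
have [i _ hi] := @arg_maxP _ _ _ i0 predT f isT.
exists i; rewrite -[leRHS]mul1r -P1 mulr_suml; apply: ler_sum => j _.
by apply: ler_wpM2l => //; exact: hi.
Qed.

(* Nonnegativity and normalisation say that [M] lists the Walsh-Fourier
   coefficients of a probability measure on the 2-cuts. *)
Lemma exists_cut_of_moments (G : multihypergraph V) (M : {set V} -> R) :
  M set0 = 1 -> (forall A, 0 <= \sum_S walsh R A S * M S) ->
  exists A, - (\sum_(e <- G) 2 ^- #|e| *
      \sum_(S : {set V} | (S \subset e) && (S != set0)) even_factor S * M S)
    <= surplus R G A.
Proof.
move=> M0 Mge.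
have n0 : (0 : R) < 2 ^+ #|V| by rewrite exprn_gt0.
pose P A := (\sum_S walsh R A S * M S) / 2 ^+ #|V|.
(* Fourier inversion, by orthogonality. *)
have PM S : \sum_A P A * walsh R A S = M S.
  rewrite /P; under eq_bigr do rewrite mulrAC mulr_suml.
  rewrite -mulr_suml exchange_big /=.
  rewrite (eq_bigr (fun S' => (S' == S)%:R * 2 ^+ #|V| * M S')) => [|S' _].
    rewrite (bigD1 S) //= eqxx mul1r big1 ?addr0 => [|S' /negbTE ->].
      by rewrite mulrC mulKf // gt_eqF.
    by rewrite !mul0r.
  by rewrite -sum_walsh2 mulr_suml; apply: eq_bigr => A _; rewrite mulrAC.
have [||A hA] := @exists_ge_mean _ P (surplus R G).
- by move=> A; rewrite divr_ge0 // ltW.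
- by rewrite -M0 -PM; apply: eq_bigr => A _; rewrite /walsh big_set0 mulr1.
exists A; apply: le_trans hA; rewrite le_eqVlt; apply/orP; left; apply/eqP.
under [RHS]eq_bigr do rewrite surplus_walsh mulrN mulr_sumr.
rewrite sumrN exchange_big; congr (- _); apply: eq_bigr => e _ /=.
under [RHS]eq_bigr do rewrite mulrCA mulr_sumr.
rewrite -mulr_sumr exchange_big; congr (_ * _); apply: eq_bigr => S _ /=.
by rewrite -PM mulr_sumr; apply: eq_bigr => B _; rewrite mulrCA.
Qed.

End Cuts.

(** * Contribution of a single edge *)

Section EdgeBound.
Variables (R : realType) (V : finType) (N : nat) (x : V -> 'rV[R]_N).
Hypothesis hx : forall u, dotv (x u) (x u) <= 4.

Lemma edge_moment_bound (e : {set V}) :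
  \sum_(S : {set V} | (S \subset e) && (S != set0)) even_factor R S * moment x S
  <= expR (-4) * pair_sum e (fun u v => dotv (x u) (x v))
     + 2 ^+ #|e| * (#|e|%:R ^+ 2 * pair_sum e (fun u v => dotv (x u) (x v) ^+ 2)).
Proof.
pose a u v := dotv (x u) (x v); set q := pair_sum e (fun u v => _ ^+ 2).
have q0 (S : {set V}) : 0 <= pair_sum S (fun u v => dotv (x u) (x v) ^+ 2).
  by apply: pair_sum_ge0 => u v; exact: sqr_ge0.
pose main (S : {set V}) : R :=
  expR (-4) * \sum_u \sum_(v | v != u) (S == [set u; v])%:R * a u v.
have term (S : {set V}) : S \subset e -> S != set0 ->
    even_factor R S * moment x S <= main S + #|e|%:R ^+ 2 * q.
  move=> Se S0; have := moment_expansion hx S0; set m := (X in `|_ + X|).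
  (* For a pair, the even factor 2 cancels the halving, [kappa] is -1 and e^(-2|S|) is e^(-4). *)
  have Em : even_factor R S * m = - main S.
    rewrite /m /main !mulr_sumr !mulr_suml mulr_sumr -sumrN; apply: eq_bigr => u _.
    rewrite !mulr_sumr !mulr_suml mulr_sumr -sumrN; apply: eq_bigr => v vu.
    have [SE|_] := eqVneq S [set u; v]; last by rewrite !(mul0r, mulr0) oppr0.
    rewrite /even_factor SE cards2 eq_sym vu kappa2 sqrrN expr1n.
    by rewrite (_ : -2 * 2%:R = - 4 :> R) ?/a; [field | ring].
  have [f0 f2] := andP (even_factor_bounds R S).
  rewrite ler_norml => /andP[_ h].
  have {}h : even_factor R S * (moment x S + m)
      <= 2 * (#|S|%:R ^+ 2 / 4 * pair_sum S (fun u v => dotv (x u) (x v) ^+ 2)).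
    apply: le_trans (ler_wpM2l f0 h) _; apply: ler_wpM2r => //.
    by rewrite mulr_ge0 // divr_ge0 ?sqr_ge0.
  have hS : #|S|%:R ^+ 2 * pair_sum S (fun u v => dotv (x u) (x v) ^+ 2)
      <= #|e|%:R ^+ 2 * q.
    apply: ler_pM => //; first exact: sqr_ge0.
      by rewrite ler_sqr ?nnegrE ?ler0n // ler_nat subset_leq_card.
    by apply: pair_sum_subset => // u v; exact: sqr_ge0.
  have hS0 : 0 <= #|S|%:R ^+ 2 * pair_sum S (fun u v => dotv (x u) (x v) ^+ 2).
    by rewrite mulr_ge0 ?sqr_ge0.
  by move: h; rewrite mulrDr Em; lra.
apply: le_trans (ler_sum _ (fun S hS => term S (andP hS).1 (andP hS).2)) _.
rewrite big_split /=; apply: lerD.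
  rewrite /main -mulr_sumr exchange_big /= ler_wpM2l ?expR_ge0 // pair_sumE.
  rewrite le_eqVlt; apply/orP; left; apply/eqP; apply: eq_bigr => u _.
  rewrite exchange_big; apply: eq_bigr => v vu /=.
  have uv0 : [set u; v] != set0 by apply/set0Pn; exists u; rewrite !inE eqxx.
  rewrite -mulr_suml; congr (_ * _); rewrite big_mkcond (bigD1 [set u; v]) //= uv0 andbT.
  rewrite eqxx big1 ?addr0; first by case: ifP.
  by move=> S /negbTE ->; rewrite if_same.
(* The error is counted once per nonempty subset of [e], at most 2^|e| times. *)
rewrite sumr_const -[_ *+ _]mulr_natl ler_wpM2r ?mulr_ge0 ?sqr_ge0 ?q0 //.
rewrite -natrX ler_nat -card_powerset; apply: subset_leq_card; apply/subsetP => S.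
by move=> /andP[]; rewrite inE.
Qed.

End EdgeBound.

(** * Summation over the edges *)

Theorem theorem2p1 (R : realType) :
  exists C : nat -> R,
    (forall s : nat, 0 < C s) /\
    forall k : nat,
    exists K : R,
      0 < K /\
      forall (V : finType) (G : multihypergraph V) (N : nat)
             (x : V -> 'rV[R]_N),
        mixed_multigraph k G ->
        (forall u : V, 1 <= norm2 (x u) <= 2) ->
        exists A : {set V},
          - (\sum_(e <- G) C #|e| *
               \sum_(u in e) \sum_(v in e | v != u) dotv (x u) (x v))
          - K * (\sum_(e <- G)
                   \sum_(u in e) \sum_(v in e | v != u) dotv (x u) (x v) ^+ 2)
          <= surplus R G A.
Proof.
(* 2^(-s) comes from the expansion of the cut indicator, e^(-4) from the moments of pairs. *)
exists (fun s => 2 ^- s * expR (-4)); split=> [s|k].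
  by rewrite mulr_gt0 ?expR_gt0 // invr_gt0 exprn_gt0.
(* k^2 bounds |e|^2; adding 1 keeps the constant positive when k = 0. *)
exists (k%:R ^+ 2 + 1); split=> [|V G N x Gk hx].
  by rewrite ltr_wpDl // sqr_ge0.
have hx4 u : dotv (x u) (x u) <= 4.
  have /andP[_] := hx u; rewrite /norm2.
  rewrite -[2](@ger0_norm R) // -sqrtr_sqr ler_sqrt ?sqr_ge0 //.
  by rewrite (_ : 2 ^+ 2 = 4 :> R) //; ring.
have [A hA] := exists_cut_of_moments G (moment0 x) (moment_ge0 hx4).
exists A; apply: le_trans hA; rewrite -opprD lerN2 mulr_sumr -big_split /=.
rewrite big_seq [leRHS]big_seq; apply: ler_sum => e eG.
have p0 : 0 < (2 : R) ^- #|e| by rewrite invr_gt0 exprn_gt0.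
apply: le_trans (ler_wpM2l (ltW p0) (edge_moment_bound hx4 e)) _.
(* The number 2^|e| of subsets cancels against 2^(-|e|). *)
rewrite mulrDr mulKf ?expf_neq0 ?pnatr_eq0 // mulrA; apply: lerD; first exact: lexx.
apply: ler_wpM2r; first by apply: pair_sum_ge0 => u v; exact: sqr_ge0.
have ek : (#|e| <= k)%N by exact: Gk.
apply: (@le_trans _ _ (k%:R ^+ 2)); last by rewrite lerDl.
by rewrite ler_sqr ?nnegrE ?ler0n // ler_nat.
Qed.
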